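(* Let $t\ge1$. There exist (on a suitable finite ground set $V$) simple $[t]$-trades of each of the following volumes: (i) $2^{t+1}+2^{t-1}-2^i$ for $i=0,\dots,t-2$; (ii) $2^{t+1}+2^{t-1}-3\cdot 2^i$ for $i=0,\dots,t-3$.
   Context: Let $V=\{1,\dots,v\}$. A $[t]$-trade is a pair $T=(T_+,T_-)$ of disjoint finite multisets of subsets of $V$ (blocks) such that for every $i\in\{0,\dots,t\}$ every $i$-subset of $V$ is contained in the same number of blocks of $T_+$ as of $T_-$ (with multiplicity). It is simple if no block is repeated; its volume is $\mathrm{vol}(T)=|T_+|=|T_-|$. *)

(* Defs.v *)
From mathcomp Require Import all_boot finmap multiset.

Set Implicit Arguments.
Unset Strict Implicit.
Unset Printing Implicit Defensive.

Local Open Scope nat_scope.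
Local Open Scope mset_scope.

(* The ground set {1, ..., v} is 'I_v; (T_+, T_-) is (T.1, T.2). *)
Definition block_pair (v : nat) : Type :=
  ({mset {set 'I_v}} * {mset {set 'I_v}})%type.

(* Number of blocks of A containing S; the coercion of a multiset to a seq
   repeats each block according to its multiplicity. *)
Definition degree (v : nat) (A : {mset {set 'I_v}}) (S : {set 'I_v}) : nat :=
  count (fun B : {set 'I_v} => S \subset B) A.

Definition is_trade (t v : nat) (T : block_pair v) : Prop :=
  mdisjoint T.1 T.2 /\
  (forall i : nat, i <= t -> forall S : {set 'I_v}, #|S| = i ->
     degree T.1 S = degree T.2 S).

Definition simple_trade (v : nat) (T : block_pair v) : Prop :=
  uniq T.1 /\ uniq T.2.

(* For a trade this is also size T.2: see vol_trade. *)
Definition vol (v : nat) (T : block_pair v) : nat := size T.1.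

Lemma vol_trade (t v : nat) (T : block_pair v) :
  is_trade t T -> vol T = size T.2.
Proof.
case=> _ /(_ 0 (leq0n t) set0 (cards0 _)); rewrite /degree /vol.
have count_sub0 (s : seq {set 'I_v}) :
    count (fun B : {set 'I_v} => set0 \subset B) s = size s.
  by rewrite -[RHS]count_predT; apply: eq_count => B; rewrite sub0set.
by rewrite !count_sub0.
Qed.

(* Main.v *)
Require Import Defs.
From mathcomp Require Import all_boot finmap multiset zify.

(** Write a trade as a polynomial in square-free monomials with coefficients 0, 1, -1.
    Multiplying a [t]-trade by [1 - x], with [x] a new variable, gives a [t+1]-trade of
    twice the volume.  Start from the [1]-trades
    [f = (1 - y1)(1 - y2) - (1 - z1)(1 - z2)], with 6 monomials, and
    [g = - y1 (1 - a)(1 - b)] or [g = (y2 - 1)(y1 - z1)], with 4 monomials, of which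
    [c = 1], respectively [c = 3], occur in [f] with the same sign, and none with the
    opposite sign.  Multiplying [f] and [g] by [1 - x_1], ..., [1 - x_s] and
    [1 - w_1], ..., [1 - w_s] with disjoint sets of variables does not change the common
    monomials, so the difference of the two products is a simple [s+1]-trade of volume
    [3 * 2^s + 2 * 2^s - c].  Multiplying by [i] further factors [1 - u_j] multiplies the
    volume by [2^i]. *)

Local Open Scope nat_scope.

(* Blocks are encoded by their indicator bit sequences, so that adjoining a point to the
   ground set is [cons] and small cases are decided by computation. *)
Definition bitsub : bitseq -> bitseq -> bool := all2 implb.

Definition balanced (v t : nat) (P N : seq bitseq) : Prop :=
  forall S : bitseq, size S = v -> count id S <= t ->
    count (bitsub S) P = count (bitsub S) N.

(** A single [uniq] on [P ++ N] encodes both simplicity and disjointness. *)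
Definition bit_trade (v t : nat) (P N : seq bitseq) : Prop :=
  [/\ all (fun B => size B == v) (P ++ N), uniq (P ++ N) & balanced v t P N].

Definition has_volume (v t n : nat) : Prop :=
  exists P N : seq bitseq, bit_trade v t P N /\ size P = n.

Lemma all_size_cons (b : bool) (v : nat) (A : seq bitseq) :
  all (fun B => size B == v.+1) [seq b :: B | B <- A] = all (fun B => size B == v) A.
Proof. by rewrite all_map; apply: eq_all => B /=; rewrite eqSS. Qed.

Lemma uniq_cons_bit (b : bool) (A : seq bitseq) :
  uniq [seq b :: B | B <- A] = uniq A.
Proof. by apply: map_inj_uniq => x y []. Qed.

Lemma uniq_cons_bits (A B : seq bitseq) :
  uniq ([seq false :: x | x <- A] ++ [seq true :: x | x <- B]) = uniq A && uniq B.
Proof.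
rewrite cat_uniq !uniq_cons_bit; case: hasP => //= -[_ /mapP[x _ ->] /mapP[y _ //]].
Qed.

Lemma count_bitsub_cons (s b : bool) (S : bitseq) (A : seq bitseq) :
  count (bitsub (s :: S)) [seq b :: B | B <- A] =
  if s && ~~ b then 0 else count (bitsub S) A.
Proof.
by rewrite count_map; case: s; case: b => /=; rewrite ?count_pred0.
Qed.

Lemma balanced_pad (v t : nat) (P N : seq bitseq) :
  balanced v t P N ->
  balanced v.+1 t [seq false :: B | B <- P] [seq false :: B | B <- N].
Proof.
move=> balPN [//|s S] [sizeS] /= wS; rewrite !count_bitsub_cons.
by case: s wS => //= wS; apply: balPN.
Qed.

(** This is multiplication by [1 - x], with [x] the new head bit. If [S] contains the new point,
    only blocks with head [true] count and the rest of [S] has weight at most [t]; otherwise both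
    sides count all of [P] and [N]. *)
Lemma balanced_double (v t : nat) (P N : seq bitseq) :
  balanced v t P N ->
  balanced v.+1 t.+1 ([seq false :: B | B <- P] ++ [seq true :: B | B <- N])
                     ([seq false :: B | B <- N] ++ [seq true :: B | B <- P]).
Proof.
move=> balPN [//|s S] [sizeS] /= wS; rewrite !count_cat !count_bitsub_cons.
by case: s wS => /= wS; [rewrite balPN | rewrite addnC].
Qed.

(** Padding lets a single ground set serve every [i] in the theorem. *)
Lemma has_volume_pad (v t n k : nat) : has_volume v t n -> has_volume (k + v) t n.
Proof.
elim: k => // k IHk /IHk[P [N [[szPN uPN balPN] sizeP]]].
exists [seq false :: B | B <- P], [seq false :: B | B <- N]; split; last by rewrite size_map.
by split; rewrite -?map_cat ?all_size_cons ?uniq_cons_bit //; apply: balanced_pad.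
Qed.

Lemma has_volume_double (v t n k : nat) :
  has_volume v t n -> has_volume (k + v) (k + t) (2 ^ k * n).
Proof.
elim: k => [|k IHk]; first by rewrite mul1n.
case/IHk=> P [N [[szPN uPN balPN] sizeP]].
have sizeN : size P = size N.
  (* Balance at the empty set, which every block contains, compares the two sizes. *)
  have /(balPN _ (size_nseq _ _)) : count id (nseq (k + v) false) <= k + t.
    by rewrite count_nseq mul0n.
  suff count0 A : all (fun B => size B == k + v) A ->
      count (bitsub (nseq (k + v) false)) A = size A.
    by move: szPN; rewrite all_cat => /andP[szP szN]; rewrite !count0.
  move=> /allP szA; rewrite -[RHS]count_predT; apply: eq_in_count => B /szA/eqP <-.
  by rewrite /bitsub; elim: B.
exists ([seq false :: B | B <- P] ++ [seq true :: B | B <- N]),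
       ([seq false :: B | B <- N] ++ [seq true :: B | B <- P]).
split; last by rewrite size_cat !size_map -sizeN sizeP expnS addnn -mul2n mulnA.
have uNP : uniq (N ++ P) by rewrite uniq_catC.
split; last exact: balanced_double.
- move: szPN; rewrite all_cat => /andP[szP szN].
  by rewrite !all_cat !all_size_cons szP szN.
rewrite (@perm_uniq _ _ ([seq false :: B | B <- P ++ N] ++ [seq true :: B | B <- N ++ P])).
  by rewrite uniq_cons_bits uPN.
by apply/permP => a; rewrite !map_cat !count_cat; lia.
Qed.

(* Two trades [(C ++ P0, E ++ N0)] and [(C ++ P1, E ++ N1)] whose common blocks are those
   of [C] and [E]. *)
Definition overlapping (v t : nat) (C E P0 N0 P1 N1 : seq bitseq) : Prop :=
  [/\ all (fun B => size B == v) (C ++ E ++ P0 ++ N0 ++ P1 ++ N1),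
      uniq (C ++ E ++ P0 ++ N0 ++ P1 ++ N1),
      balanced v t (C ++ P0) (E ++ N0)
    & balanced v t (C ++ P1) (E ++ N1)].

(** Subtracting the second trade from the first cancels [C] and [E] and swaps the signs of [P1] and
    [N1]. *)
Lemma overlapping_diff (v t : nat) (C E P0 N0 P1 N1 : seq bitseq) :
  overlapping v t C E P0 N0 P1 N1 -> bit_trade v t (P0 ++ N1) (N0 ++ P1).
Proof.
case=> sz u bal0 bal1; have sigma : perm_eq (C ++ E ++ P0 ++ N0 ++ P1 ++ N1)
    ((C ++ E) ++ (P0 ++ N1) ++ N0 ++ P1).
  by apply/permP => a; rewrite !count_cat; lia.
split.
- by move: sz; rewrite (perm_all _ sigma) all_cat => /andP[].
- by move: u; rewrite (perm_uniq sigma) cat_uniq => /and3P[].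
move=> S sizeS wS; move: (bal0 S sizeS wS) (bal1 S sizeS wS).
by rewrite !count_cat; lia.
Qed.

(** The second bit is the new variable of the first trade, the head bit that of the second. Common
    blocks keep both bits [false], so no new ones arise. *)
Lemma overlapping_step (v t : nat) (C E P0 N0 P1 N1 : seq bitseq) :
  overlapping v t C E P0 N0 P1 N1 ->
  exists C' E' P0' N0' P1' N1' : seq bitseq,
    [/\ overlapping v.+2 t.+1 C' E' P0' N0' P1' N1',
        size C' = size C /\ size E' = size E,
        size (C' ++ P0') = size (C ++ P0) + size (E ++ N0) /\
        size (E' ++ N0') = size (C ++ P0) + size (E ++ N0)
      & size (C' ++ P1') = size (C ++ P1) + size (E ++ N1) /\
        size (E' ++ N1') = size (C ++ P1) + size (E ++ N1)].
Proof.
case=> sz u bal0 bal1.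
pose ff (A : seq bitseq) := [seq false :: B | B <- [seq false :: B | B <- A]].
pose ft (A : seq bitseq) := [seq false :: B | B <- [seq true :: B | B <- A]].
pose tf (A : seq bitseq) := [seq true :: B | B <- [seq false :: B | B <- A]].
have sigma0 : perm_eq (C ++ E ++ P0 ++ N0 ++ P1 ++ N1)
    ((C ++ P0 ++ E ++ N0) ++ P1 ++ N1).
  by apply/permP => a; rewrite !count_cat; lia.
have sigma1 : perm_eq (C ++ E ++ P0 ++ N0 ++ P1 ++ N1)
    ((C ++ P1 ++ E ++ N1) ++ P0 ++ N0).
  by apply/permP => a; rewrite !count_cat; lia.
(* Sorted by their two new bits, the blocks are distinct as soon as those within each group are. *)
have sigma : perm_eq
    (ff C ++ ff E ++ (ff P0 ++ ft (E ++ N0)) ++ (ff N0 ++ ft (C ++ P0)) ++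
                     (ff P1 ++ tf (E ++ N1)) ++ (ff N1 ++ tf (C ++ P1)))
    ([seq false :: B | B <-
        [seq false :: B | B <- C ++ E ++ P0 ++ N0 ++ P1 ++ N1] ++
        [seq true :: B | B <- C ++ P0 ++ E ++ N0]] ++
     [seq true :: B | B <- [seq false :: B | B <- C ++ P1 ++ E ++ N1]]).
  by apply/permP => a; rewrite /ff /ft /tf !map_cat !count_cat; lia.
exists (ff C), (ff E), (ff P0 ++ ft (E ++ N0)), (ff N0 ++ ft (C ++ P0)),
       (ff P1 ++ tf (E ++ N1)), (ff N1 ++ tf (C ++ P1)).
split; first split.
- rewrite (perm_all _ sigma) all_cat !all_size_cons all_cat !all_size_cons sz.
  have := sz; rewrite (perm_all _ sigma0) all_cat => /andP[-> _].
  by have := sz; rewrite (perm_all _ sigma1) all_cat => /andP[-> _].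
- rewrite (perm_uniq sigma) !uniq_cons_bits uniq_cons_bit u.
  have := u; rewrite (perm_uniq sigma0) cat_uniq => /andP[-> _].
  by have := u; rewrite (perm_uniq sigma1) cat_uniq => /andP[-> _].
- have := balanced_pad _ _ _ _ (balanced_double _ _ _ _ bal0).
  by rewrite /ff /ft !map_cat -!catA.
- have := balanced_double _ _ _ _ (balanced_pad _ _ _ _ bal1).
  by rewrite /ff /tf !map_cat -!catA.
- by rewrite !size_map.
- by rewrite /ff /ft /tf !size_cat !size_map !size_cat -/bitseq; lia.
by rewrite /ff /ft /tf !size_cat !size_map !size_cat -/bitseq; lia.
Qed.

Lemma has_volume_overlapping (v s c : nat) (C E P0 N0 P1 N1 : seq bitseq) :
  overlapping v 1 C E P0 N0 P1 N1 ->
  size (C ++ P0) = 3 -> size (E ++ N0) = 3 ->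
  size (C ++ P1) = 2 -> size (E ++ N1) = 2 -> size C + size E = c ->
  has_volume (2 * s + v) s.+1 (5 * 2 ^ s - c).
Proof.
move=> ov sP0 sN0 sP1 sN1 sc.
suff [C' [E' [P0' [N0' [P1' [N1' [ov' sc' [sP0' _] [_ sN1']]]]]]]] :
  exists C' E' P0' N0' P1' N1' : seq bitseq,
    [/\ overlapping (2 * s + v) s.+1 C' E' P0' N0' P1' N1',
        size C' + size E' = c,
        size (C' ++ P0') = 3 * 2 ^ s /\ size (E' ++ N0') = 3 * 2 ^ s
      & size (C' ++ P1') = 2 * 2 ^ s /\ size (E' ++ N1') = 2 * 2 ^ s].
  exists (P0' ++ N1'), (N0' ++ P1'); split; first exact: overlapping_diff ov'.
  by move: sc' sP0' sN1'; rewrite !size_cat; lia.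
elim: s => [|s [C' [E' [P0' [N0' [P1' [N1' [ov' sc' [sP0' sN0'] [sP1' sN1']]]]]]]]].
  by exists C, E, P0, N0, P1, N1.
have [C2 [E2 [P02 [N02 [P12 [N12 [ov2 [sC sE] [sP02 sN02] [sP12 sN12]]]]]]]] :=
  overlapping_step _ _ _ _ _ _ _ _ ov'.
exists C2, E2, P02, N02, P12, N12; split.
- by rewrite mulnS.
- by rewrite sC sE.
- by rewrite sP02 sN02 expnS; lia.
by rewrite sP12 sN12 expnS; lia.
Qed.

(* The coordinates are y1, y2, z1, z2, a, b. *)
Lemma has_volume_base1 (s : nat) : has_volume (2 * s + 6) s.+1 (5 * 2 ^ s - 1).
Proof.
pose bits (l : seq nat) := [seq j == 1 | j <- l].
(* The only monomial common to [f] and [g = - y1 (1 - a)(1 - b)] is [- y1]. *)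
apply: (has_volume_overlapping _ _ _ [::] [:: bits [:: 1; 0; 0; 0; 0; 0]]
  [:: bits [:: 1; 1; 0; 0; 0; 0]; bits [:: 0; 0; 1; 0; 0; 0]; bits [:: 0; 0; 0; 1; 0; 0]]
  [:: bits [:: 0; 1; 0; 0; 0; 0]; bits [:: 0; 0; 1; 1; 0; 0]]
  [:: bits [:: 1; 0; 0; 0; 1; 0]; bits [:: 1; 0; 0; 0; 0; 1]]
  [:: bits [:: 1; 0; 0; 0; 1; 1]]) => //; split=> //.
- by do 6![case=> [//|[]]]; case.
by do 6![case=> [//|[]]]; case.
Qed.

(* The coordinates are y1, y2, z1, z2. *)
Lemma has_volume_base3 (s : nat) : has_volume (2 * s + 4) s.+1 (5 * 2 ^ s - 3).
Proof.
pose bits (l : seq nat) := [seq j == 1 | j <- l].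
(* Common to [f] and [g = (y2 - 1)(y1 - z1)] are [y1 y2], [z1] and [- y1]; only [- y2 z1] remains of
   [g]. *)
apply: (has_volume_overlapping _ _ _
  [:: bits [:: 1; 1; 0; 0]; bits [:: 0; 0; 1; 0]] [:: bits [:: 1; 0; 0; 0]]
  [:: bits [:: 0; 0; 0; 1]] [:: bits [:: 0; 1; 0; 0]; bits [:: 0; 0; 1; 1]]
  [::] [:: bits [:: 0; 1; 1; 0]]) => //; split=> //.
- by do 4![case=> [//|[]]]; case.
by do 4![case=> [//|[]]]; case.
Qed.

Definition block_of (v : nat) (B : bitseq) : {set 'I_v} := [set x : 'I_v | nth false B x].

(** This left inverse makes [block_of] injective on sequences of length [v], so distinct bit blocks
    stay distinct as sets. *)
Lemma enum_block (v : nat) (B : bitseq) :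
  size B = v -> [seq x \in block_of v B | x <- enum 'I_v] = B.
Proof.
move=> sizeB; under eq_map => x do rewrite inE.
by rewrite (map_comp (nth false B) val) val_enum_ord map_nth_iota0 ?take_oversize ?sizeB.
Qed.

Lemma bitsub_block (v : nat) (S : {set 'I_v}) (B : bitseq) :
  size B = v ->
  bitsub [seq x \in S | x <- enum 'I_v] B = (S \subset block_of v B).
Proof.
move=> sizeB; rewrite -[X in bitsub _ X](enum_block _ _ sizeB) /bitsub all2E !size_map eqxx.
rewrite zip_map all_map /=; apply/allP/subsetP => [sub x Sx | sub x _ /=].
  by have /= := sub x (mem_enum 'I_v x); rewrite Sx.
by apply/implyP => /sub.
Qed.

Lemma trade_of_has_volume (v t n : nat) :
  has_volume v t n ->
  exists T : block_pair v, [/\ is_trade t T, simple_trade T & vol T = n].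
Proof.
case=> P [N [[/allP szPN uPN balPN] sizeP]].
have inj_block : {in P ++ N &, injective (block_of v)}.
  move=> A B /szPN/eqP sA /szPN/eqP sB eqAB.
  by rewrite -(enum_block _ _ sA) -(enum_block _ _ sB) eqAB.
have : uniq [seq block_of v B | B <- P ++ N] by rewrite map_inj_in_uniq.
rewrite map_cat cat_uniq => /and3P[uP dPN uN].
have degreeE A (S : {set 'I_v}) : {subset A <= P ++ N} ->
    degree (seq_mset [seq block_of v B | B <- A]) S =
    count (bitsub [seq x \in S | x <- enum 'I_v]) A.
  move=> subA; rewrite /degree (permP (perm_eq_seq_mset _)) count_map.
  by apply: eq_in_count => B /subA/szPN/eqP sB; rewrite bitsub_block.
exists (seq_mset [seq block_of v B | B <- P], seq_mset [seq block_of v B | B <- N]).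
split; first split.
- apply/eqP/msetP => B /=; rewrite msetE2 !mset_seqE mset0E !count_uniq_mem //.
  case: (boolP (B \in _)) => [BP|]; last by rewrite min0n.
  have /negbTE-> // : B \notin [seq block_of v B | B <- N].
  by apply/negP => BN; case/hasP: dPN; exists B.
- move=> i le_it S cardS /=; rewrite !degreeE; first 1 last.
  + by move=> B; rewrite mem_cat orbC => ->.
  + by move=> B; rewrite mem_cat => ->.
  apply: balPN; first by rewrite size_map size_enum_ord.
  by rewrite (leq_trans _ le_it) // -cardS count_map enumT cardE size_filter.
- by split; rewrite (perm_uniq (perm_eq_seq_mset _)).
by rewrite /vol (perm_size (perm_eq_seq_mset _)) size_map.
Qed.

Theorem theorem5p3 (t : nat) (ht : 1 <= t) :
  exists v : nat,
    (forall i : nat, i + 2 <= t ->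
       exists T : block_pair v,
         [/\ is_trade t T, simple_trade T
           & vol T = 2 ^ (t + 1) + 2 ^ (t - 1) - 2 ^ i]) /\
    (forall i : nat, i + 3 <= t ->
       exists T : block_pair v,
         [/\ is_trade t T, simple_trade T
           & vol T = 2 ^ (t + 1) + 2 ^ (t - 1) - 3 * 2 ^ i]).
Proof.
(* With [t = i + s + 1], the two leading powers add up to [5 * 2 ^ (i + s)]. *)
have volE i s c : 2 ^ (i + s.+1 + 1) + 2 ^ (i + s.+1 - 1) - c * 2 ^ i =
    2 ^ i * (5 * 2 ^ s - c).
  have -> : i + s.+1 + 1 = (i + s).+2 by lia.
  have -> : i + s.+1 - 1 = i + s by lia.
  by rewrite mulnBr !expnS expnD; lia.
have split_t i : i + 2 <= t -> exists s, t = i + s.+1.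
  by move=> le_it; exists (t - i.+1); lia.
(* The constructions use [i + 2 * s + 6] and [i + 2 * s + 4] points, both below [2 * t + 6]. *)
exists (2 * t + 6); split=> i le_it; apply: trade_of_has_volume.
  have [s def_t] := split_t i le_it.
  rewrite -[in X in _ - X](mul1n (2 ^ i)) def_t volE.
  have -> : 2 * (i + s.+1) + 6 = (i + 2) + (i + (2 * s + 6)) by lia.
  exact/has_volume_pad/has_volume_double/has_volume_base1.
have [s def_t] : exists s, t = i + s.+1 by apply: split_t; lia.
rewrite def_t volE.
have -> : 2 * (i + s.+1) + 6 = (i + 4) + (i + (2 * s + 4)) by lia.
exact/has_volume_pad/has_volume_double/has_volume_base3.
Qed.
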